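(* Let $n\geq 2$ and let $\Diamond:\mathcal{K}^n\to\mathcal{K}^n$ be an operator. Then $\Diamond$ is continuous, $\mathrm{GL}(n)$-covariant and translation invariant if and only if there is a real number $\lambda\geq 0$ such that $\Diamond K=\lambda DK$ for all $K\in\mathcal{K}^n$.
   Context: $\mathcal{K}^n$ denotes the set of convex bodies (nonempty compact convex sets, not necessarily with interior points) in $\mathbb{R}^n$, with the Hausdorff metric; continuity is with respect to this metric. The difference body of $K$ is $DK=K+(-K)$ (Minkowski sum), where $-K=\{-x:x\in K\}$. The operator $\Diamond$ is $\mathrm{GL}(n)$-covariant if $\Diamond(gK)=g\,\Diamond K$ for all $K\in\mathcal{K}^n$ and all $g\in\mathrm{GL}(n)$. It is translation invariant if $\Diamond(K+t)=\Diamond K$ for all $K\in\mathcal{K}^n$ and all $t\in\mathbb{R}^n$. *)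

(* Defs.v *)
From HB Require Import structures.
From mathcomp Require Import all_boot all_order all_algebra.
From mathcomp Require Import all_classical all_reals all_analysis.
From mathcomp Require Import ring lra.

Set Implicit Arguments.
Unset Strict Implicit.
Unset Printing Implicit Defensive.

Import Order.TTheory GRing.Theory Num.Theory.
Import numFieldNormedType.Exports.

Local Open Scope classical_set_scope.
Local Open Scope ring_scope.

(* The library norm on ['rV[R]_n] is the max norm; the Hausdorff metric is
   taken with respect to the Euclidean norm instead. *)
Section EuclideanNorm.
Variables (R : realType) (n : nat).
Implicit Types (u v : 'rV[R]_n).

Definition enorm v : R := Num.sqrt (\sum_(i < n) v ord0 i ^+ 2).

Lemma enorm_sumsq_ge0 v : 0 <= \sum_(i < n) v ord0 i ^+ 2.
Proof. by apply: sumr_ge0 => i _; exact: sqr_ge0. Qed.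

Lemma enorm_ge0 v : 0 <= enorm v.
Proof. exact: sqrtr_ge0. Qed.

Lemma sqr_enorm v : enorm v ^+ 2 = \sum_(i < n) v ord0 i ^+ 2.
Proof. by rewrite sqr_sqrtr// enorm_sumsq_ge0. Qed.

Lemma enorm0 : enorm 0 = 0.
Proof.
by rewrite /enorm big1 ?sqrtr0// => i _; rewrite mxE expr0n.
Qed.

Lemma enormN v : enorm (- v) = enorm v.
Proof. by congr Num.sqrt; apply: eq_bigr => i _; rewrite mxE sqrrN. Qed.

Lemma enorm_cauchy_schwarz u v :
  \sum_(i < n) u ord0 i * v ord0 i <= enorm u * enorm v.
Proof.
set a := enorm u; set b := enorm v; set d := \sum_(i < n) _.
have a0 : 0 <= a := enorm_ge0 u.
have b0 : 0 <= b := enorm_ge0 v.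
have q s t : 0 <= s ^+ 2 * a ^+ 2 - 2 * (s * t) * d + t ^+ 2 * b ^+ 2.
  have -> : s ^+ 2 * a ^+ 2 - 2 * (s * t) * d + t ^+ 2 * b ^+ 2
      = \sum_(i < n) (s * u ord0 i - t * v ord0 i) ^+ 2.
    rewrite /a /b /d !sqr_enorm !mulr_sumr -sumrB -big_split/=.
    by apply: eq_bigr => i _; ring.
  by apply: sumr_ge0 => i _; exact: sqr_ge0.
have ab0 : 0 <= a * b by rewrite mulr_ge0.
rewrite leNgt; apply/negP => dab.
have d0 : 0 < d by rewrite (le_lt_trans ab0).
have H1 := q d (a ^+ 2).
have H2 := q (b ^+ 2) d.
have H3 := q 1 1.
have [az|an0] := eqVneq a 0.
  have := q (b ^+ 2 + 1) d; rewrite az; nra.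
have ap : 0 < a by rewrite lt_neqAle eq_sym an0.
have H4 : 0 <= a ^+ 2 * (a ^+ 2 * b ^+ 2 - d ^+ 2) by nra.
rewrite pmulr_rge0 ?exprn_gt0// subr_ge0 -exprMn in H4.
by move: H4; rewrite ler_sqr ?nnegrE ?(ltW d0)// leNgt dab.
Qed.

Lemma ler_enormD u v : enorm (u + v) <= enorm u + enorm v.
Proof.
rewrite -ler_sqr ?nnegrE ?addr_ge0 ?enorm_ge0// sqr_enorm sqrrD !sqr_enorm.
have -> : \sum_(i < n) (u + v) ord0 i ^+ 2 = \sum_(i < n) u ord0 i ^+ 2
    + (\sum_(i < n) u ord0 i * v ord0 i) *+ 2 + \sum_(i < n) v ord0 i ^+ 2.
  rewrite -sumrMnl -!big_split/=.
  by apply: eq_bigr => i _; rewrite mxE sqrrD.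
by rewrite lerD2r lerD2l lerMn2r enorm_cauchy_schwarz.
Qed.

Lemma enorm_distC u v : enorm (u - v) = enorm (v - u).
Proof. by rewrite -enormN opprB. Qed.

Lemma ler_enorm_distD w u v : enorm (u - v) <= enorm (u - w) + enorm (w - v).
Proof. by rewrite (le_trans _ (ler_enormD _ _))// subrKA. Qed.

Lemma coord_le_mx_norm v i : `|v ord0 i| <= `|v|.
Proof.
by rewrite [leRHS]/Num.norm/= mx_normrE; apply/bigmax_geP; right; exists (ord0, i).
Qed.

Lemma mx_norm_le_enorm v : `|v| <= enorm v.
Proof.
rewrite [leLHS]/Num.norm/= mx_normrE; apply/bigmax_leP; split.
  exact: enorm_ge0.
move=> [i j] _ /=; rewrite (ord1 i) -sqrtr_sqr ler_sqrt ?enorm_sumsq_ge0//.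
by rewrite (bigD1 j)//= lerDl sumr_ge0// => k _; exact: sqr_ge0.
Qed.

Lemma enorm_le_mx_norm v : enorm v <= Num.sqrt n%:R * `|v|.
Proof.
rewrite -[X in _ * X]ger0_norm// -sqrtr_sqr -sqrtrM ?ler0n//.
rewrite ler_sqrt ?mulr_ge0 ?sqr_ge0//.
rewrite mulr_natl -[X in _ *+ X]card_ord -sumr_const ler_sum// => i _.
by rewrite -(real_normK (num_real (v ord0 i))) ler_sqr ?nnegrE// coord_le_mx_norm.
Qed.

End EuclideanNorm.

Section ConvexBody.
Variables (R : realType) (n : nat).

Definition is_convex_body (A : set 'rV[R]_n) : Prop :=
  [/\ A !=set0, compact A & convex_set A].

Record convex_body := ConvexBody {
  body_set :> set 'rV[R]_n;
  body_setP : is_convex_body body_set }.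

Lemma body_nonempty (K : convex_body) : body_set K !=set0.
Proof. by case: (body_setP K). Qed.

Lemma body_compact (K : convex_body) : compact (body_set K).
Proof. by case: (body_setP K). Qed.

Lemma body_convex (K : convex_body) : convex_set (body_set K).
Proof. by case: (body_setP K). Qed.

Lemma convex_body_eq (K L : convex_body) : body_set K = body_set L -> K = L.
Proof.
case: K => K hK; case: L => L hL /= KL.
subst L; congr ConvexBody; exact: Prop_irrelevance.
Qed.

HB.instance Definition _ := gen_eqMixin convex_body.
HB.instance Definition _ := gen_choiceMixin convex_body.

End ConvexBody.

Section HausdorffMetric.
Variables (R : realType) (n : nat).
Implicit Types K L M : convex_body R n.

(* [A] is contained in the Minkowski sum of [B] and the closed Euclidean ball
   of radius [r]. *)
Definition in_parallel_body (A B : set 'rV[R]_n) (r : R) : Prop :=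
  forall x, A x -> exists2 y, B y & enorm (x - y) <= r.

Definition hausdorff_bounds K L : set R :=
  [set r | 0 <= r /\ in_parallel_body K L r /\ in_parallel_body L K r].

Definition hausdorff_dist K L : R := inf (hausdorff_bounds K L).

Lemma body_enorm_bounded K : exists M : R, forall x, body_set K x -> enorm x <= M.
Proof.
have [M [_ KM]] := compact_bounded (@body_compact _ _ K).
exists (Num.sqrt n%:R * (M + 1)) => x Kx.
apply: (le_trans (enorm_le_mx_norm x)).
by rewrite ler_wpM2l ?sqrtr_ge0// KM// ltrDl.
Qed.

Lemma hausdorff_bounds_nonempty K L : hausdorff_bounds K L !=set0.
Proof.
have [k hk] := body_enorm_bounded K; have [l hl] := body_enorm_bounded L.
have [x Kx] := body_nonempty K; have [y Ly] := body_nonempty L.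
have kl0 : 0 <= k + l.
  by rewrite addr_ge0// (le_trans (enorm_ge0 _) (hk _ Kx), le_trans (enorm_ge0 _) (hl _ Ly)).
have b u v : body_set K u -> body_set L v -> enorm (u - v) <= k + l.
  move=> Ku Lv; apply: (le_trans (ler_enormD _ _)).
  by rewrite enormN lerD// ?hk ?hl.
exists (k + l); split=> //; split=> z Hz.
  by exists y => //; exact: b.
by exists x => //; rewrite enorm_distC; exact: b.
Qed.

Lemma hausdorff_bounds_lbound K L : lbound (hausdorff_bounds K L) 0.
Proof. by move=> r []. Qed.

Lemma hausdorff_bounds_has_inf K L : has_inf (hausdorff_bounds K L).
Proof.
split; first exact: hausdorff_bounds_nonempty.
by exists 0; exact: hausdorff_bounds_lbound.
Qed.

Lemma hausdorff_bounds_sym K L : hausdorff_bounds K L = hausdorff_bounds L K.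
Proof. by apply/seteqP; split => r [r0 [? ?]]; split. Qed.

Lemma hausdorff_dist_ge0 K L : 0 <= hausdorff_dist K L.
Proof.
apply: lb_le_inf; first exact: hausdorff_bounds_nonempty.
exact: hausdorff_bounds_lbound.
Qed.

Lemma hausdorff_dist_le K L r : hausdorff_bounds K L r -> hausdorff_dist K L <= r.
Proof. by move=> h; apply: ge_inf => //; have [] := hausdorff_bounds_has_inf K L. Qed.

Lemma hausdorff_dist_approx K L (e : R) : 0 < e ->
  exists2 r, hausdorff_bounds K L r & r < hausdorff_dist K L + e.
Proof. by move=> e0; apply: inf_adherent => //; exact: hausdorff_bounds_has_inf. Qed.

Lemma hausdorff_distxx K : hausdorff_dist K K = 0.
Proof.
apply/eqP; rewrite eq_le hausdorff_dist_ge0 andbT; apply: hausdorff_dist_le.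
by split=> //; split=> x Kx; exists x; rewrite // subrr enorm0.
Qed.

Lemma hausdorff_dist_sym K L : hausdorff_dist K L = hausdorff_dist L K.
Proof. by rewrite /hausdorff_dist hausdorff_bounds_sym. Qed.

Lemma in_parallel_body_trans (A B C : set 'rV[R]_n) r s :
  in_parallel_body A B r -> in_parallel_body B C s -> in_parallel_body A C (r + s).
Proof.
move=> AB BC x /AB[y /BC[z Cz yz] xy]; exists z => //.
by rewrite (le_trans (ler_enorm_distD y _ _))// lerD.
Qed.

Lemma hausdorff_dist_triangle L K M :
  hausdorff_dist K M <= hausdorff_dist K L + hausdorff_dist L M.
Proof.
apply/ler_addgt0Pl => e e0; have e20 : 0 < e / 2 by rewrite divr_gt0.
have [r [r0 [KL LK]] hr] := hausdorff_dist_approx K L e20.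
have [s [s0 [LM ML]] hs] := hausdorff_dist_approx L M e20.
apply: (@le_trans _ _ (r + s)).
  apply: hausdorff_dist_le; split; first exact: addr_ge0.
  split; first exact: in_parallel_body_trans KL LM.
  by rewrite addrC; exact: in_parallel_body_trans ML LK.
rewrite (le_trans (lerD (ltW hr) (ltW hs)))//.
by rewrite addrACA -splitr addrC.
Qed.

Lemma hausdorff_dist0_sub K L : hausdorff_dist K L = 0 -> K `<=` L.
Proof.
move=> KL0 x Kx.
have Lcl : closed (L : set 'rV[R]_n).
  by apply: compact_closed; [exact: norm_hausdorff|exact: body_compact].
apply: Lcl => A /nbhs_ballP[e /= e0 eA].
have [r [r0 [KL _]]] := hausdorff_dist_approx K L e0.
rewrite KL0 add0r => re; have [y Ly xy] := KL _ Kx.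
exists y; split=> //; apply: eA; rewrite -ball_normE/=.
exact: le_lt_trans (le_trans (mx_norm_le_enorm _) xy) re.
Qed.

Lemma hausdorff_dist_positivity K L : hausdorff_dist K L = 0 -> K = L.
Proof.
move=> KL0; apply: convex_body_eq; apply/seteqP.
by split; apply: hausdorff_dist0_sub => //; rewrite hausdorff_dist_sym.
Qed.

HB.instance Definition _ := @isMetric.Build R (convex_body R n)
  hausdorff_dist hausdorff_distxx hausdorff_dist_positivity
  hausdorff_dist_sym hausdorff_dist_triangle.

End HausdorffMetric.


Section Operations.
Variables (R : realType) (n : nat).
Implicit Types (K L : convex_body R n) (A B : set 'rV[R]_n).

Lemma continuous_mulmxr (g : 'M[R]_n) :
  continuous (fun x : 'rV[R]_n => x *m g).
Proof.
under eq_fun do rewrite mulmx_sum_row.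
apply: continuous_big => /=; first exact: add_continuous.
move=> i _ y; apply: (@cvgZr_tmp _ _ _ (nbhs y)); exact: coord_continuous.
Qed.

(* Vectors are rows, so a matrix [g] acts by [x |-> x *m g]. *)
Definition linear_image_set (g : 'M[R]_n) A : set 'rV[R]_n :=
  [set x *m g | x in A].
Definition translate_set (t : 'rV[R]_n) A : set 'rV[R]_n :=
  [set x + t | x in A].
Definition dilate_set (c : R) A : set 'rV[R]_n := [set c *: x | x in A].
Definition reflect_set A : set 'rV[R]_n := [set - x | x in A].
Definition minkowski_sum_set A B : set 'rV[R]_n :=
  [set x + y | x in A & y in B].

Lemma image_body_subproof K (f : 'rV[R]_n -> 'rV[R]_n) : continuous f ->
  (forall (t : {i01 R}) x y, f (t%:num *: x + (1 - t%:num) *: y)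
     = t%:num *: f x + (1 - t%:num) *: f y) ->
  is_convex_body (f @` K).
Proof.
move=> cf af; split.
- by have [x Kx] := body_nonempty K; exists (f x); exists x.
- apply: continuous_compact; last exact: body_compact.
  exact: continuous_subspaceT.
- move=> x y t /set_mem[u Ku <-] /set_mem[v Kv <-]; apply/mem_set.
  exists (t%:num *: u + (1 - t%:num) *: v); last exact: af.
  by apply/set_mem; apply: body_convex; exact/mem_set.
Qed.

Lemma linear_image_subproof (g : 'M[R]_n) K : is_convex_body (linear_image_set g K).
Proof.
apply: image_body_subproof; first exact: continuous_mulmxr.
by move=> t x y; rewrite mulmxDl -!scalemxAl.
Qed.

Lemma translate_subproof (t : 'rV[R]_n) K : is_convex_body (translate_set t K).
Proof.
apply: image_body_subproof.
  by move=> x; apply: (@cvgD _ _ _ (nbhs x)); [exact: cvg_id|exact: cvg_cst].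
move=> s x y; rewrite !scalerDr addrACA; congr (_ + _).
by rewrite -scalerDl addrC subrK scale1r.
Qed.

Lemma dilate_subproof (c : R) K : is_convex_body (dilate_set c K).
Proof.
apply: image_body_subproof.
  by move=> x; apply: (@cvgZl_tmp _ _ _ (nbhs x)); exact: cvg_id.
by move=> t x y; rewrite scalerDr !scalerA ![c * _]mulrC.
Qed.

Lemma reflect_subproof K : is_convex_body (reflect_set K).
Proof.
apply: image_body_subproof; first exact: opp_continuous.
by move=> t x y; rewrite opprD !scalerN.
Qed.

Lemma minkowski_sum_subproof K L :
  is_convex_body (minkowski_sum_set K L).
Proof.
split=> /=.
- have [x Kx] := body_nonempty K; have [y Ly] := body_nonempty L.
  by exists (x + y); exists x => //; exists y.
- rewrite (_ : minkowski_sum_set K L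
      = (fun z : 'rV[R]_n * 'rV[R]_n => z.1 + z.2) @` (K `*` L)).
    apply: continuous_compact.
      by apply: continuous_subspaceT; exact: add_continuous.
    by apply: compact_setX; exact: body_compact.
  apply/seteqP; split=> [_ [x Kx [y Ly <-]]|_ [[x y] [/= Kx Ly] <-]].
    by exists (x, y).
  by exists x => //; exists y.
- move=> _ _ t /set_mem[x Kx [y Ly <-]] /set_mem[x' Kx' [y' Ly' <-]].
  apply/mem_set; exists (t%:num *: x + (1 - t%:num) *: x').
    by apply/set_mem; apply: body_convex; exact/mem_set.
  exists (t%:num *: y + (1 - t%:num) *: y').
    by apply/set_mem; apply: body_convex; exact/mem_set.
  by rewrite addrACA -!scalerDr.
Qed.

Definition linear_image (g : 'M[R]_n) K : convex_body R n :=
  ConvexBody (linear_image_subproof g K).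

Definition translate (t : 'rV[R]_n) K : convex_body R n :=
  ConvexBody (translate_subproof t K).

Definition dilate (c : R) K : convex_body R n :=
  ConvexBody (dilate_subproof c K).

Definition minkowski_sum K L : convex_body R n :=
  ConvexBody (minkowski_sum_subproof K L).

Definition reflect_body K : convex_body R n :=
  ConvexBody (reflect_subproof K).

Definition difference_body K : convex_body R n :=
  minkowski_sum K (reflect_body K).

Definition GL_covariant (Phi : convex_body R n -> convex_body R n) : Prop :=
  forall (g : 'M[R]_n) K, g \in unitmx ->
    Phi (linear_image g K) = linear_image g (Phi K).

Definition translation_invariant
    (Phi : convex_body R n -> convex_body R n) : Prop :=
  forall (t : 'rV[R]_n) K, Phi (translate t K) = Phi K.

End Operations.

(* Main.v *)
(* By density of GL(n) and continuity, [Phi] commutes with every linear map,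
   singular ones included.  The rank one map [x |-> <x, u> e] sends [K] to a
   translate of a multiple of the segment [0, e], so all the projections of
   [Phi K] to lines, and hence [Phi K], are determined by [Phi [0, e]]; this
   holds for every operator with the three properties, in particular for
   [lambda D].  Finally [Phi [0, e]] lies on the line spanned by [e], as [0, e]
   is fixed by a projection onto that line, and is symmetric about 0, as
   [- [0, e]] is a translate of [0, e]: it is [lambda D [0, e]] for some
   [lambda >= 0]. *)
Require Import Defs.
From mathcomp Require Import all_boot all_order all_algebra.
From mathcomp Require Import all_classical all_reals all_analysis.
From mathcomp Require Import ring lra.

Import Order.TTheory GRing.Theory Num.Theory.
Import numFieldNormedType.Exports.

Set Implicit Arguments.
Unset Strict Implicit.
Unset Printing Implicit Defensive.

Local Open Scope classical_set_scope.
Local Open Scope ring_scope.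

(** * Density of the invertible matrices *)

(** [g + t%:M] is singular only if [t] is an eigenvalue of [- g], that is, a root of a monic
    polynomial. The candidates [d / i.+2] are infinitely many, so one of them is not a root. *)
Lemma addr_scalar_unitmx (F : numFieldType) n (g : 'M[F]_n) (d : F) :
  0 < d -> exists2 t, 0 < t < d & g + t%:M \in unitmx.
Proof.
move=> d0; pose p := char_poly (- g); pose s i : F := d / i.+2%:R.
have s_itv i : 0 < s i < d.
  by rewrite divr_gt0//= ltr_pdivrMr// ltr_pMr// ltr1n.
have s_inj : injective s.
  move=> i j /(mulfI (lt0r_neq0 d0)) /invr_inj/eqP.
  by rewrite eqr_nat => /eqP[].
have [i iP] : exists i, ~~ root p (s i).
  apply/not_existsP => allroot.
  (* [size p] distinct roots are one more than the degree of [p] allows. *)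
  have := @max_poly_roots _ p (map s (iota 0 (size p))).
  rewrite size_map size_iota ltnn (map_inj_uniq s_inj) iota_uniq.
  move=> /(_ (monic_neq0 (char_poly_monic _)))/(_ _ isT) H.
  have //: false; apply: H; apply/allP => _ /mapP[i _ ->].
  by apply/negPn/negP; exact: allroot.
exists (s i) => //; move: iP; rewrite -eigenvalue_root_char negbK.
rewrite kermx_eq0 row_free_unit -opprD -scaleN1r.
by rewrite unitmxZ// unitrN1.
Qed.

Section Bodies.
Variables (R : realType) (n : nat).
Implicit Types (K L : convex_body R n) (x y u v : 'rV[R]_n).

(** * Continuity and extension to singular matrices *)

Lemma body_conv K x y (t : R) : 0 <= t -> t <= 1 -> body_set K x -> body_set K y ->
  body_set K (t *: x + (1 - t) *: y).
Proof.
move=> t0 t1 Kx Ky; apply/set_mem.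
exact: (@body_convex _ _ K x y (Itv01 t0 t1) (mem_set Kx) (mem_set Ky)).
Qed.

Lemma continuous_convex_bodyP (Phi : convex_body R n -> convex_body R n) :
  continuous Phi <-> forall K e, 0 < e -> exists2 d, 0 < d &
    forall L, hausdorff_dist K L < d -> hausdorff_dist (Phi K) (Phi L) < e.
Proof.
split=> [cPhi K e e0|H K].
  have /nbhs_ballP[d /= d0 dP] := cPhi K _ (nbhsx_ballx (Phi K) e e0).
  by exists d => // L KL; have := dP L; rewrite /= !ballEmdist; exact.
move=> A /nbhs_ballP[e /= e0 eA]; have [d d0 dP] := H K e e0.
apply/nbhs_ballP; exists d => //= L; rewrite ballEmdist => KL.
by apply: eA; rewrite ballEmdist; exact: dP.
Qed.

Lemma hausdorff_dist_linear_image (g h : 'M[R]_n) K r : 0 <= r ->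
  (forall x, body_set K x -> enorm (x *m g - x *m h) <= r) ->
  hausdorff_dist (linear_image g K) (linear_image h K) <= r.
Proof.
move=> r0 H; apply: hausdorff_dist_le; split=> //.
split=> _ [x Kx <-]; first by exists (x *m h); [exists x|exact: H].
by exists (x *m g); [exists x|rewrite enorm_distC; exact: H].
Qed.

Lemma enormZ (t : R) x : 0 <= t -> enorm (t *: x) = t * enorm x.
Proof.
move=> t0; rewrite /enorm; under eq_bigr do rewrite mxE exprMn.
by rewrite -mulr_sumr sqrtrM ?sqr_ge0// sqrtr_sqr ger0_norm.
Qed.

Lemma linear_image_add_scalar (g : 'M[R]_n) K e : 0 < e ->
  exists2 d, 0 < d & forall t, 0 < t < d ->
    hausdorff_dist (linear_image g K) (linear_image (g + t%:M) K) < e.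
Proof.
move=> e0; have [M MP] := body_enorm_bounded K.
have M0 : 0 <= M by have [x /MP] := body_nonempty K; apply: le_trans (enorm_ge0 _).
(* Adding [t%:M] moves each point [x] of the image by [t *: x], hence by at most [t * M]; the [+ 1]
   avoids a zero denominator. *)
exists (e / (M + 1)); first by rewrite divr_gt0// ltr_wpDl.
move=> t /andP[t0]; rewrite ltr_pdivlMr ?ltr_wpDl// => te.
apply: le_lt_trans te; apply: hausdorff_dist_linear_image => [|x Kx].
  by rewrite mulr_ge0 ?(ltW t0)// addr_ge0.
rewrite mulmxDr opprD addrA subrr add0r enormN mul_mx_scalar enormZ ?(ltW t0)//.
by rewrite ler_pM2l// (le_trans (MP _ Kx))// lerDl.
Qed.

Lemma GL_covariant_all_matrices (Phi : convex_body R n -> convex_body R n) :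
  continuous Phi -> GL_covariant Phi ->
  forall (g : 'M[R]_n) K, Phi (linear_image g K) = linear_image g (Phi K).
Proof.
move=> /continuous_convex_bodyP cPhi cov g K.
apply: hausdorff_dist_positivity; apply/eqP.
rewrite eq_le hausdorff_dist_ge0 andbT; apply/ler_addgt0Pr => e e0.
rewrite add0r; have e20 : 0 < e / 2 by rewrite divr_gt0.
have [d d0 dP] := cPhi (linear_image g K) _ e20.
have [d1 d10 d1P] := linear_image_add_scalar g K d0.
have [d2 d20 d2P] := linear_image_add_scalar g (Phi K) e20.
have dm : 0 < Num.min d1 d2 by rewrite lt_min d10.
have [t /andP[t0]] := addr_scalar_unitmx g dm.
rewrite lt_min => /andP[td1 td2] gt.
(* The intermediate body is also [linear_image (g + t%:M) (Phi K)]: continuity of [Phi] bounds one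
   distance, the perturbation of [g] on [Phi K] the other. *)
apply: (le_trans (hausdorff_dist_triangle (Phi (linear_image (g + t%:M) K)) _ _)).
rewrite [leRHS]splitr lerD//.
  by apply/ltW/dP/d1P; rewrite t0.
by rewrite cov// hausdorff_dist_sym; apply/ltW/d2P; rewrite t0.
Qed.

(** * Inner products and separation *)

(** The form as a matrix product reduces [mulmx_rank_one] to associativity. *)
Definition dotv x u : R := (x *m u^T) 0 0.

Lemma dotvE x u : dotv x u = \sum_(i < n) x ord0 i * u ord0 i.
Proof. by rewrite /dotv mxE; apply: eq_bigr => i _; rewrite mxE. Qed.

Lemma dotvDl x y u : dotv (x + y) u = dotv x u + dotv y u.
Proof. by rewrite /dotv mulmxDl mxE. Qed.

Lemma dotvBl x y u : dotv (x - y) u = dotv x u - dotv y u.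
Proof. by rewrite /dotv mulmxBl !mxE. Qed.

Lemma dotvZl (c : R) x u : dotv (c *: x) u = c * dotv x u.
Proof. by rewrite /dotv -scalemxAl mxE. Qed.

Lemma dotvC x u : dotv x u = dotv u x.
Proof. by rewrite !dotvE; apply: eq_bigr => i _; rewrite mulrC. Qed.

Lemma dotvNN x u : dotv (- x) (- u) = dotv x u.
Proof. by rewrite !dotvE; apply: eq_bigr => i _; rewrite !mxE mulrNN. Qed.

Lemma dotv_sqrB (c : R) x u : dotv (c *: x - u) (c *: x - u) =
  c ^+ 2 * dotv x x - 2 * c * dotv x u + dotv u u.
Proof.
rewrite dotvBl dotvZl ![dotv _ (_ - _)]dotvC !(dotvBl, dotvZl) (dotvC u x); ring.
Qed.

Lemma dotv_continuous u : continuous (dotv^~ u).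
Proof.
rewrite (_ : dotv^~ u = fun x => \sum_(i < n) x ord0 i * u ord0 i); last first.
  by apply/funext => x; exact: dotvE.
apply: continuous_big => /=; first exact: add_continuous.
move=> i _ x; apply: (@cvgMr_tmp _ _ (nbhs x)); exact: coord_continuous.
Qed.

Lemma dotvv_continuous : continuous (fun x => dotv x x).
Proof.
under eq_fun do rewrite dotvE.
apply: continuous_big => /=; first exact: add_continuous.
move=> i _ x; apply: (@cvgM _ _ (nbhs x)); exact: coord_continuous.
Qed.

Lemma dotvv_ge0 x : 0 <= dotv x x.
Proof. by rewrite dotvE sumr_ge0// => i _; rewrite -expr2 sqr_ge0. Qed.

Lemma dotvv_eq0 x : dotv x x = 0 -> x = 0.
Proof.
rewrite dotvE => /eqP; rewrite psumr_eq0; last by move=> i _; rewrite -expr2 sqr_ge0.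
move=> /allP H; apply/rowP => i; rewrite mxE.
by apply/eqP; have := H i (mem_index_enum _); rewrite /= mulf_eq0 orbb.
Qed.

Lemma compact_min_max K (f : 'rV[R]_n -> R) : continuous f ->
  (exists2 a, body_set K a & forall x, body_set K x -> f a <= f x) /\
  (exists2 b, body_set K b & forall x, body_set K x -> f x <= f b).
Proof.
move=> cf; have cfK : {within (K : set 'rV[R]_n), continuous f}.
  exact: continuous_subspaceT.
split.
  have [a /set_mem Ka aP] := EVT_min_rV (body_nonempty K) (@body_compact _ _ K) cfK.
  by exists a => // x Kx; apply: aP; exact: mem_set.
have [a /set_mem Ka aP] := EVT_max_rV (body_nonempty K) (@body_compact _ _ K) cfK.
by exists a => // x Kx; apply: aP; exact: mem_set.
Qed.

(* The separating direction is [x - y] with [y] the point of [K] nearest to [x]. *)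
Lemma separation K x : ~ body_set K x ->
  exists u, forall y, body_set K y -> dotv y u < dotv x u.
Proof.
move=> Kx.
have cf : continuous (fun y => dotv (y - x) (y - x)).
  move=> y; apply: (@continuous_comp _ _ _ (fun y => y - x) (fun z => dotv z z)).
    by apply: (@cvgB _ _ _ (nbhs y)); [exact: cvg_id|exact: cvg_cst].
  exact: dotvv_continuous.
have [[y Ky ymin] _] := compact_min_max K cf.
have yx : 0 < dotv (x - y) (x - y).
  rewrite lt_neqAle dotvv_ge0 andbT eq_sym; apply/eqP => /dotvv_eq0/subr0_eq xy.
  by apply: Kx; rewrite xy.
exists (x - y) => z Kz; set u := x - y in yx *.
suff : dotv (z - y) u <= 0.
  by move: yx; rewrite {1}/u !dotvBl => ? ?; lra.
rewrite leNgt; apply/negP => p0.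
have q0 := dotvv_ge0 (z - y).
set p := dotv (z - y) u in p0; set q := dotv (z - y) (z - y) in q0.
(* The point [t *: z + (1 - t) *: y] of [K] is no nearer to [x] than [y]; expand the squared
   distances. *)
have H (t : R) : 0 <= t -> t <= 1 -> 2 * t * p <= t ^+ 2 * q.
  move=> t0 t1; have := ymin _ (body_conv t0 t1 Kz Ky).
  have -> : t *: z + (1 - t) *: y - x = t *: (z - y) - u.
    by apply/rowP => i; rewrite /u !mxE; ring.
  have -> : y - x = - u by rewrite /u opprB.
  by rewrite dotvNN dotv_sqrB -/p -/q; lra.
(* [t = p / q] minimizes [t ^+ 2 * q - 2 * t * p]; if it exceeds 1, the endpoint [t = 1] already
   gives a contradiction. *)
have [pq|qp] := leP p q.
  have q1 : 0 < q by exact: lt_le_trans pq.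
  have := H (p / q); rewrite divr_ge0 ?(ltW p0)// ler_pdivrMr// mul1r pq.
  move=> /(_ isT isT).
  have -> : (p / q) ^+ 2 * q = p / q * p by field; rewrite gt_eqF.
  have : 0 < p / q * p by rewrite mulr_gt0// divr_gt0.
  by rewrite -mulrA; lra.
by have := H 1 ler01 (lexx _); rewrite expr1n mul1r; lra.
Qed.

(** A point of one body outside the other would be strictly separated from it, so its value in the
    separating direction would be missing from the other projection. *)
Lemma body_eq_dotv K L :
  (forall u, [set dotv x u | x in K] = [set dotv x u | x in L]) -> K = L.
Proof.
suff sub K' L' : (forall u, [set dotv x u | x in K'] = [set dotv x u | x in L']) ->
    body_set K' `<=` L'.
  move=> KL; apply: convex_body_eq; apply/seteqP; split; first exact: sub.
  by apply: sub => u; rewrite KL.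
move=> KL x Kx; apply: contrapT => /separation[u uP].
have : [set dotv x u | x in K'] (dotv x u) by exists x.
by rewrite KL => -[y Ly yx]; have := uP y Ly; rewrite yx ltxx.
Qed.

(** * The three properties of the operators [lambda D] *)

(** The operator is Lipschitz with constant [2 * c], as both points of a difference may move; the
    proof takes [2 * c + 1], which is positive even for [c = 0]. *)
Lemma continuous_dilate_difference_body (c : R) : 0 <= c ->
  continuous (fun K => dilate c (difference_body K)).
Proof.
move=> c0; apply/continuous_convex_bodyP => K e e0.
have c1 : 0 < 2 * c + 1 by lra.
exists (e / (2 * c + 1)); first by rewrite divr_gt0.
move=> L; rewrite ltr_pdivlMr// => KLe.
(* The distance is an infimum, so an actual bound [r] close enough to it is chosen. *)
have [r [r0 [KL LK]] hr] : exists2 r, hausdorff_bounds K L r & r * (2 * c + 1) < e.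
  have d0 : 0 < e / (2 * c + 1) - hausdorff_dist K L.
    by rewrite subr_gt0 ltr_pdivlMr.
  have [r rb] := hausdorff_dist_approx K L d0.
  by rewrite addrC subrK ltr_pdivlMr// => re; exists r.
apply: le_lt_trans hr; apply: hausdorff_dist_le; split.
  by rewrite mulr_ge0// ltW.
suff sub (A B : set 'rV[R]_n) : in_parallel_body A B r -> in_parallel_body
    (dilate_set c (minkowski_sum_set A (reflect_set A)))
    (dilate_set c (minkowski_sum_set B (reflect_set B))) (r * (2 * c + 1)).
  by split; exact: sub.
move=> AB _ [_ [x Ax [_ [y Ay <-] <-]] <-].
have [x' Bx' xx'] := AB _ Ax; have [y' By' yy'] := AB _ Ay.
exists (c *: (x' - y')).
  by exists (x' - y') => //; exists x' => //; exists (- y') => //; exists y'.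
have -> : c *: (x - y) - c *: (x' - y') = c *: ((x - x') - (y - y')).
  by apply/rowP => i; rewrite !mxE; ring.
rewrite enormZ// (le_trans (ler_wpM2l c0 (ler_enormD _ _)))// enormN.
by have := ler_wpM2l c0 (lerD xx' yy'); lra.
Qed.

Lemma linear_image_dilate_difference_body (c : R) (g : 'M[R]_n) K :
  dilate c (difference_body (linear_image g K)) =
  linear_image g (dilate c (difference_body K)).
Proof.
apply: convex_body_eq; apply/seteqP; split.
  move=> _ [_ [_ [x Kx <-] [_ [_ [y Ky <-] <-] <-]] <-].
  exists (c *: (x - y)); last by rewrite -scalemxAl mulmxBl.
  by exists (x - y) => //; exists x => //; exists (- y) => //; exists y.
move=> _ [_ [_ [x Kx [_ [y Ky <-] <-]] <-] <-].
exists (x *m g - y *m g); last by rewrite -scalemxAl mulmxBl.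
exists (x *m g); first by exists x.
by exists (- (y *m g)) => //; exists (y *m g) => //; exists y.
Qed.

Lemma translate_dilate_difference_body (c : R) t K :
  dilate c (difference_body (translate t K)) = dilate c (difference_body K).
Proof.
apply: convex_body_eq; apply/seteqP; split.
  move=> _ [_ [_ [x Kx <-] [_ [_ [y Ky <-] <-] <-]] <-].
  exists (x - y); last by rewrite opprD addrACA subrr addr0.
  by exists x => //; exists (- y) => //; exists y.
move=> _ [_ [x Kx [_ [y Ky <-] <-]] <-].
exists (x + t - (y + t)); last by rewrite opprD addrACA subrr addr0.
exists (x + t); first by exists x.
by exists (- (y + t)) => //; exists (y + t) => //; exists y.
Qed.

(** * Segments and rank one maps *)

Lemma unit_segment_subproof u : is_convex_body [set t *: u | t in `[0, 1]].
Proof.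
split.
- by exists (0 *: u); exists 0 => //=; rewrite in_itv/= lexx ler01.
- apply: continuous_compact; last exact: segment_compact.
  apply: continuous_subspaceT => t.
  by apply: (@cvgZr_tmp _ _ _ (nbhs t)); exact: cvg_id.
- move=> _ _ t /set_mem[a /= + <-] /set_mem[b /= + <-].
  rewrite !in_itv/= => /andP[a0 a1] /andP[b0 b1]; apply/mem_set.
  have t0 : 0 <= t%:num by [].
  have t1 : t%:num <= 1 by [].
  exists (t%:num * a + (1 - t%:num) * b); last by rewrite scalerDl -!scalerA.
  by rewrite /= in_itv/=; apply/andP; split; nra.
Qed.

Definition unit_segment u : convex_body R n := ConvexBody (unit_segment_subproof u).

Lemma mulmx_rank_one x u (e : 'rV[R]_n) : x *m (u^T *m e) = dotv x u *: e.
Proof. by rewrite mulmxA [x *m _]mx11_scalar mul_scalar_mx. Qed.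

(** Here [m] is the minimum of [dotv^~ u] on [K] and [w] the width of [K] in direction [u];
    convexity yields all values in between. The scaling is by a matrix [w%:M], singular when [w = 0]
    and [n > 0], so that covariance under all matrices applies to it. *)
Lemma linear_image_rank_one K u (e : 'rV[R]_n) : exists m w : R,
  linear_image (u^T *m e) K =
  translate (m *: e) (linear_image w%:M (unit_segment e)).
Proof.
have [[a Ka aP] [b Kb bP]] := compact_min_max K (@dotv_continuous u).
exists (dotv a u), (dotv b u - dotv a u).
apply: convex_body_eq; apply/seteqP; split.
  move=> _ [x Kx <-]; rewrite mulmx_rank_one.
  set m := dotv a u in aP *; set M := dotv b u in bP *.
  have := aP _ Kx; have := bP _ Kx; set d := dotv x u => dM md.
  exists ((d - m) *: e); last by rewrite -scalerDl subrK.
  (* When the width vanishes, the image is a single point and no division by [M - m] is possible. *)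
  have [mM|Mm] := ltP m M; last first.
    have -> : d = m by apply/eqP; rewrite eq_le md (le_trans dM Mm).
    exists (0 *: e); last by rewrite !(scale0r, mul0mx) subrr scale0r.
    by exists 0 => //=; rewrite in_itv/= lexx ler01.
  have Mm0 : 0 < M - m by rewrite subr_gt0.
  exists ((d - m) / (M - m) *: e).
    exists ((d - m) / (M - m)) => //=; rewrite in_itv/=.
    by rewrite divr_ge0 ?subr_ge0// ?(ltW mM)// ler_pdivrMr// mul1r lerD2r.
  by rewrite mul_mx_scalar scalerA mulrC divfK// gt_eqF.
move=> _ [_ [_ [t /= + <-] <-] <-]; rewrite in_itv/= => /andP[t0 t1].
exists (t *: b + (1 - t) *: a); first exact: body_conv.
rewrite mulmx_rank_one mul_mx_scalar scalerA -scalerDl dotvDl !dotvZl.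
by congr (_ *: _); ring.
Qed.

Lemma covariant_operators_eq (Phi Psi : convex_body R n -> convex_body R n)
    (e : 'rV[R]_n) : e != 0 ->
  continuous Phi -> GL_covariant Phi -> translation_invariant Phi ->
  continuous Psi -> GL_covariant Psi -> translation_invariant Psi ->
  Phi (unit_segment e) = Psi (unit_segment e) -> Phi =1 Psi.
Proof.
move=> e0 cPhi gPhi tPhi cPsi gPsi tPsi PhiPsi K; apply: body_eq_dotv => u.
have covPhi := GL_covariant_all_matrices cPhi gPhi.
have covPsi := GL_covariant_all_matrices cPsi gPsi.
have [m [w Kmw]] := linear_image_rank_one K u e.
have E : linear_image (u^T *m e) (Phi K) = linear_image (u^T *m e) (Psi K).
  (* The translation disappears by invariance and [w%:M] moves outside, leaving the values on the
     segment. *)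
  by rewrite -covPhi -covPsi Kmw tPhi tPsi covPhi covPsi PhiPsi.
have sub (A B : set 'rV[R]_n) :
    linear_image_set (u^T *m e) A `<=` linear_image_set (u^T *m e) B ->
    [set dotv x u | x in A] `<=` [set dotv x u | x in B].
  (* Since [e] is nonzero, the multiple [dotv x u *: e] determines its coefficient. *)
  move=> AB _ [x Ax <-]; have [|y By] := AB (x *m (u^T *m e)); first by exists x.
  rewrite !mulmx_rank_one => /eqP; rewrite -subr_eq0 -scalerBl scaler_eq0.
  by rewrite (negbTE e0) orbF subr_eq0 => /eqP <-; exists y.
by have /(congr1 (@body_set _ _))/= ES := E; apply/seteqP; split; apply: sub; rewrite ES.
Qed.

(** The difference body of [[0, u]] is [[-u, u]]. *)
Lemma dilate_difference_body_unit_segment u z (c : R) : 0 <= c ->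
  body_set (dilate c (difference_body (unit_segment u))) z <->
  exists2 a, `|a| <= c & z = a *: u.
Proof.
move=> c0; split.
  move=> [_ [_ [a /= + <-] [_ [_ [b /= + <-] <-] <-]] <-].
  rewrite !in_itv/= => /andP[a0 a1] /andP[b0 b1].
  exists (c * (a - b)); last by rewrite -scalerBl scalerA.
  rewrite normrM ger0_norm// -[leRHS]mulr1 ler_wpM2l// ler_norml; lra.
move=> [a ac ->].
have [q q1 ->] : exists2 q, `|q| <= 1 & a = c * q.
  have [cz|cN0] := eqVneq c 0.
    by exists 0; rewrite ?normr0// mulr0; apply/eqP; rewrite -normr_le0 -cz.
  exists (a / c); last by rewrite mulrC divfK.
  by rewrite normrM normfV (ger0_norm c0) ler_pdivrMr ?mul1r// lt_neqAle eq_sym cN0.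
move: q1; rewrite ler_norml => /andP[qN1 q1].
(* [q] is the difference of [(1 + q) / 2] and [(1 - q) / 2], both in [[0, 1]]. *)
exists (q *: u); last by rewrite scalerA.
exists (((1 + q) / 2) *: u).
  by exists ((1 + q) / 2) => //=; rewrite in_itv/=; apply/andP; split; lra.
exists (- (((1 - q) / 2) *: u)).
  exists (((1 - q) / 2) *: u) => //; exists ((1 - q) / 2) => //=.
  by rewrite in_itv/=; apply/andP; split; lra.
by rewrite -scalerBl; congr (_ *: _); field.
Qed.

Lemma covariant_operator_unit_segment (Phi : convex_body R n -> convex_body R n)
    (e : 'rV[R]_n) : dotv e e = 1 ->
  continuous Phi -> GL_covariant Phi -> translation_invariant Phi ->
  exists2 c, 0 <= c &
    Phi (unit_segment e) = dilate c (difference_body (unit_segment e)).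
Proof.
move=> ee cPhi gPhi tPhi; have cov := GL_covariant_all_matrices cPhi gPhi.
set I := unit_segment e; set S := Phi I.
have S_line s : body_set S s -> s = dotv s e *: e.
  (* As [dotv e e = 1], the matrix [e^T *m e] is the orthogonal projection onto the line of [e]; it
     fixes [I], hence also [S]. *)
  have IP : linear_image (e^T *m e) I = I.
    apply: convex_body_eq; apply/seteqP; split.
      move=> _ [_ [t /= t01 <-] <-].
      by rewrite mulmx_rank_one dotvZl ee mulr1; exists t.
    move=> _ [t t01 <-]; exists (t *: e); first by exists t.
    by rewrite mulmx_rank_one dotvZl ee mulr1.
  rewrite /S -IP cov => -[x _ <-].
  by rewrite mulmx_rank_one dotvZl ee mulr1.
have S_sym s : body_set S s -> body_set S (- s).
  have IN : linear_image (-1)%:M I = translate (- e) I.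
    apply: convex_body_eq; apply/seteqP; split.
      move=> _ [_ [t /= + <-] <-]; rewrite in_itv/= => /andP[t0 t1].
      exists ((1 - t) *: e).
        by exists (1 - t) => //=; rewrite in_itv/=; apply/andP; split; lra.
      by rewrite mul_mx_scalar scaleN1r scalerBl scale1r addrAC subrr sub0r.
    move=> _ [_ [t /= + <-] <-]; rewrite in_itv/= => /andP[t0 t1].
    exists ((1 - t) *: e).
      by exists (1 - t) => //=; rewrite in_itv/=; apply/andP; split; lra.
    by rewrite mul_mx_scalar scaleN1r scalerBl scale1r opprB.
  move=> Ss; have : body_set (linear_image (-1)%:M S) (- s).
    by exists s => //; rewrite mul_mx_scalar scaleN1r.
  by rewrite -cov IN tPhi.
(* The scalar [c] is the largest coordinate along [e] on [S]; symmetry makes the smallest one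
   [- c]. *)
have [_ [b Sb bP]] := compact_min_max S (@dotv_continuous e).
set c := dotv b e in bP.
have dotvN x : dotv (- x) e = - dotv x e by rewrite -scaleN1r dotvZl mulN1r.
have c0 : 0 <= c by have := bP _ (S_sym _ Sb); rewrite dotvN -/c; lra.
exists c => //; apply: convex_body_eq; apply/seteqP; split=> z.
  move=> Sz; apply/(dilate_difference_body_unit_segment _ _ c0).
  exists (dotv z e); last exact: S_line.
  rewrite ler_norml bP// andbT.
  by have := bP _ (S_sym _ Sz); rewrite dotvN; lra.
move=> /(dilate_difference_body_unit_segment _ _ c0)[a].
rewrite ler_norml => /andP[ca ac ->].
have [cz|cN0] := eqVneq c 0.
  have -> : a = c by move: ca ac; rewrite cz; lra.
  by rewrite -S_line.
have cp : 0 < c by rewrite lt_neqAle eq_sym cN0.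
(* The weight [t = (c + a) / (2 * c)] solves [t * c - (1 - t) * c = a], which places [a *: e]
   between [- b] and [b]. *)
have t0 : 0 <= (c + a) / (2 * c) by rewrite divr_ge0; lra.
have t1 : (c + a) / (2 * c) <= 1 by rewrite ler_pdivrMr; lra.
have := body_conv t0 t1 Sb (S_sym _ Sb).
rewrite (S_line _ Sb) -/c scalerN !scalerA -scalerBl.
by congr (body_set S (_ *: _)); field.
Qed.

End Bodies.

Theorem theorem1p3 (R : realType) (n : nat) (hn : (2 <= n)%N)
    (Phi : convex_body R n -> convex_body R n) :
  [/\ continuous Phi, GL_covariant Phi & translation_invariant Phi] <->
  exists lambda : R, 0 <= lambda /\
    forall K : convex_body R n, Phi K = dilate lambda (difference_body K).
Proof.
split=> [[cPhi gPhi tPhi]|[c [c0 PhiE]]].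
  (* The first standard basis vector serves as unit vector. *)
  pose e : 'rV[R]_n := delta_mx 0 (Ordinal (ltnW hn)).
  have ee : dotv e e = 1.
    rewrite dotvE (bigD1 (Ordinal (ltnW hn)))//= big1 ?addr0 => [|i /negbTE iN].
      by rewrite mxE !eqxx mulr1.
    by rewrite mxE iN andbF mul0r.
  have e0 : e != 0.
    apply/eqP => ez; move: ee; rewrite ez dotvE big1 => [/esym/eqP|i _].
      by rewrite oner_eq0.
    by rewrite mxE mul0r.
  have [c c0 PhiI] := covariant_operator_unit_segment ee cPhi gPhi tPhi.
  (* [Phi] and [c D] agree on the segment [[0, e]], hence everywhere. *)
  exists c; split=> //; apply: (covariant_operators_eq e0) PhiI => //.
  - exact: continuous_dilate_difference_body.
  - by move=> g K _; exact: linear_image_dilate_difference_body.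
  - by move=> t K; exact: translate_dilate_difference_body.
have -> : Phi = fun K => dilate c (difference_body K) by apply/funext.
split.
- exact: continuous_dilate_difference_body.
- by move=> g K _; exact: linear_image_dilate_difference_body.
- by move=> t K; exact: translate_dilate_difference_body.
Qed.
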